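(* Let $d\ge1$ and let $k\in[1,d]$ be a real number. Then the ($d$-dimensional) volume of $\rho_{d,k}$ is $$\frac{2^d\,k^{\lfloor k\rfloor-d}}{\lfloor k\rfloor!}.$$
   Context: $\gamma_d=[-1,1]^d\subset\mathbb{R}^d$ is the hypercube, and $\beta_d=\mathrm{conv}\{\pm e_1,\dots,\pm e_d\}$ is the cross-polytope whose vertices are the centers of the facets of $\gamma_d$. For $k\in[1,d]$, $\rho_{d,k}=\mathrm{conv}\left(\beta_d\cup\frac{1}{k}\gamma_d\right)$. *)

(* Defs.v *)
From HB Require Import structures.
From mathcomp Require Import all_boot all_order all_algebra.
From mathcomp Require Import all_classical all_reals all_analysis.

Set Implicit Arguments.
Unset Strict Implicit.
Unset Printing Implicit Defensive.

Import Order.TTheory GRing.Theory Num.Theory.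
Import numFieldNormedType.Exports.

Local Open Scope classical_set_scope.
Local Open Scope ring_scope.

Definition tcons (T : Type) (n : nat) (p : T * n.-tuple T) : n.+1.-tuple T :=
  [tuple of p.1 :: p.2].

Definition tuncons (T : Type) (n : nat) (t : n.+1.-tuple T) : T * n.-tuple T :=
  (thead t, [tuple of behead t]).

Lemma tconsK (T : Type) (n : nat) : cancel (@tcons T n) (@tuncons T n).
Proof.
move=> [x t]; rewrite /tuncons /tcons theadE; congr pair.
by apply: val_inj.
Qed.

Section tuple_measurable.
Context d (T : measurableType d) (n : nat).

Lemma measurable_tcons :
  measurable_fun [set: T * n.-tuple T] (@tcons T n).
Proof. exact: measurable_cons. Qed.

Lemma measurable_tuncons : measurable_fun [set: n.+1.-tuple T] (@tuncons T n).
Proof.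
apply: measurable_fun_pair; first exact: measurable_tnth.
exact: measurable_behead.
Qed.

End tuple_measurable.

Section tuple_product_measure.
Context d (T : measurableType d) (R : realType) (n : nat).
Variables (m1 : {sigma_finite_measure set T -> \bar R})
  (m2 : {sigma_finite_measure set n.-tuple T -> \bar R}).

Definition cons_measure : set (n.+1.-tuple T) -> \bar R :=
  pushforward (m1 \x m2)%E (@tcons T n).

Let cons_measure0 : cons_measure set0 = 0%E.
Proof. by rewrite /cons_measure /pushforward preimage_set0 measure0. Qed.

Let cons_measure_ge0 A : (0 <= cons_measure A)%E.
Proof. exact: integral_ge0. Qed.

Let cons_measure_sigma_additive : semi_sigma_additive cons_measure.
Proof.
have mf := @measurable_tcons d T n.
exact: (@measure_semi_sigma_additive _ _ _ (pushforward (m1 \x m2)%E (@tcons T n))).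
Qed.

HB.instance Definition _ := isMeasure.Build _ _ _ cons_measure
  cons_measure0 cons_measure_ge0 cons_measure_sigma_additive.

Let cons_measure_sigma_finite : sigma_finite setT cons_measure.
Proof.
have /sigma_finiteP[F [TF ndF Foo]] := sigma_finiteT m1.
have /sigma_finiteP[G [TG ndG Goo]] := sigma_finiteT m2.
exists (fun i => @tuncons T n @^-1` (F i `*` G i)).
  rewrite -preimage_bigcup; apply/esym; rewrite -subTset => t _ /=.
  have [i _ Fi] : (\bigcup_i F i) (tuncons t).1 by rewrite -TF.
  have [j _ Gj] : (\bigcup_i G i) (tuncons t).2 by rewrite -TG.
  exists (maxn i j) => //; split.
    by move: Fi; apply/subsetPset/ndF/leq_maxl.
  by move: Gj; apply/subsetPset/ndG/leq_maxr.
move=> i; have [mF Fi] := Foo i; have [mG Gi] := Goo i; split.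
  rewrite -[_ @^-1` _]setTI; apply: measurable_tuncons => //.
  exact: measurableX.
rewrite /cons_measure /pushforward -comp_preimage.
rewrite (_ : @tuncons T n \o @tcons T n = id); last first.
  by rewrite funeqE => x /=; rewrite tconsK.
by rewrite preimage_id product_measure1E// lte_mul_pinfty// ge0_fin_numE.
Qed.

HB.instance Definition _ :=
  Measure_isSigmaFinite.Build _ _ _ cons_measure cons_measure_sigma_finite.

End tuple_product_measure.

Section lebesgue.
Context (R : realType).
Local Notation Rm := (measurableTypeR R).

(* The d-dimensional Lebesgue measure on the Borel sets of R^d, as the d-fold
   product of the Lebesgue measure of the line. *)
Fixpoint lebesgue_tuple (d : nat) :
    {sigma_finite_measure set (d.-tuple Rm) -> \bar R} :=
  match d with
  | 0 => @dirac _ _ ([tuple] : 0.-tuple Rm) R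
  | d'.+1 => cons_measure (@lebesgue_measure R) (lebesgue_tuple d')
  end.

Lemma measurable_box (d : nat) (B : 'I_d -> set Rm) :
  (forall i, measurable (B i)) ->
  measurable [set t : d.-tuple Rm | forall i, B i (tnth t i)].
Proof.
move=> mB.
rewrite (_ : [set _ | _] =
    \bigcap_(i in [set: 'I_d]) ((fun t : d.-tuple Rm => tnth t i) @^-1` B i)).
  apply: fin_bigcap_measurable => //.
  by move=> i _; rewrite -[_ @^-1` _]setTI; exact: measurable_tnth.
by apply/seteqP; split=> [t Bt i _|t Bt i]; exact: Bt.
Qed.

Lemma lebesgue_tuple_box (d : nat) (B : 'I_d -> set Rm) :
  (forall i, measurable (B i)) ->
  lebesgue_tuple d [set t | forall i, B i (tnth t i)] =
  (\prod_(i < d) lebesgue_measure (B i))%E.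
Proof.
elim: d B => [|d IH] B mB.
  by rewrite big_ord0 /= diracE mem_set// => -[].
rewrite big_ord_recl -IH; last by move=> i; exact: mB.
have mt := @measurable_box d (fun i => B (lift ord0 i)) (fun=> mB _).
rewrite /= /cons_measure /pushforward -product_measure1E//.
congr (product_measure1 _ _ _); apply/seteqP; split=> -[x t] /=.
  move=> Bt; split=> [|i]; first exact: (Bt ord0).
  by have := Bt (lift ord0 i); rewrite tnthS.
move=> [Bx Bt] i; case: (unliftP ord0 i) => [j ->|-> //].
by rewrite tnthS; exact: Bt.
Qed.

Definition volume (d : nat) (A : set 'rV[R]_d) : \bar R :=
  lebesgue_tuple d [set t | A (\row_i tnth t i)].

Lemma volume_box (d : nat) (B : 'I_d -> set Rm) :
  (forall i, measurable (B i)) ->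
  volume [set x | forall i, B i (x 0 i)] =
  (\prod_(i < d) lebesgue_measure (B i))%E.
Proof.
move=> mB; rewrite -lebesgue_tuple_box// /volume; congr (lebesgue_tuple d _).
by apply/seteqP; split=> t /= Bt i; have := Bt i; rewrite mxE.
Qed.

End lebesgue.

Definition convex_hull (R : realType) (d : nat) (A : set 'rV[R]_d) :
    set 'rV[R]_d :=
  smallest (@convex_set R 'rV[R]_d) A.

Definition hypercube (R : realType) (d : nat) : set 'rV[R]_d :=
  [set x | forall i, -1 <= x 0 i <= 1].
Arguments hypercube : clear implicits.

Definition cross_polytope (R : realType) (d : nat) : set 'rV[R]_d :=
  convex_hull [set x | exists i : 'I_d, x = delta_mx 0 i \/ x = - delta_mx 0 i].
Arguments cross_polytope : clear implicits.

Definition rho (R : realType) (d : nat) (k : R) : set 'rV[R]_d :=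
  convex_hull
    (cross_polytope R d `|` [set k^-1 *: x | x in hypercube R d]).
Arguments rho : clear implicits.

(* Main.v *)
Require Import Defs.
From mathcomp Require Import all_boot all_order all_fingroup all_algebra.
From mathcomp Require Import all_classical all_reals all_analysis.
From mathcomp Require Import measurable_realfun.
From mathcomp Require Import ring lra.

Import Order.TTheory GRing.Theory Num.Theory.
Import numFieldNormedType.Exports.

Local Open Scope ring_scope.

(* A point x lies in rho_{d,k} iff k s + sum_i max(|x_i| - s, 0) <= 1 for some
   level s >= 0: clipping x at level s splits it into a point of s gamma_d and a
   point of (1 - k s) beta_d. Let V_d(r) be the volume of the part of this body
   in the positive orthant, with 1 replaced by r. Split the (d+1)-dimensional
   orthant into d + 1 congruent pieces according to which coordinate is the
   smallest. If a is the smallest coordinate, then subtracting a from the others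
   lowers the gauge by exactly min(k, d+1) a, so that
     V_{d+1}(r) = (d+1) int_0^{r/m} V_d(r - m a) da   with m = min(k, d+1),
   whence V_d(r) = r^d / prod_{j <= d} min(k, j). Reflections contribute 2^d. *)

(** * Product Lebesgue measure: uniqueness on boxes, and behaviour under coordinatewise maps and
    permutations *)

Section lebesgue_tuple_theory.
Context {R : realType}.
Local Open Scope classical_set_scope.
Local Notation Rm := (measurableTypeR R).
Local Notation box B := [set t : _.-tuple Rm | forall i, B i (tnth t i)].

(** Boxes form a pi-system generating the product sigma-algebra, and the cubes with sides [[-n, n]]
    exhaust the space with finite measure. *)
Lemma box_measure_unique (d : nat)
    (m1 m2 : {measure set (d.-tuple Rm) -> \bar R}) :
  (forall B : 'I_d -> set Rm, (forall i, measurable (B i)) ->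
    m1 (box B) = m2 (box B)) ->
  (forall n : nat, m1 (box (fun=> `[(- n%:R)%R, n%:R%R])) < +oo)%E ->
  forall A, measurable A -> m1 A = m2 A.
Proof.
move=> m12 m1fin A mA.
pose C : set (set (d.-tuple Rm)) :=
  [set X | exists2 B : 'I_d -> set Rm, (forall i, measurable (B i)) & X = box B].
pose g (n : nat) := box (fun=> `[(- n%:R)%R, n%:R%R]%classic) : set (d.-tuple Rm).
apply: (measure_unique C g) => //.
- rewrite eqEsubset; split.
    apply: smallest_sub; first exact: smallest_sigma_algebra.
    rewrite -bigcup_seq => _ [i _ [B mB <-]].
    (* A cylinder over coordinate [i] is a box whose other sides are full lines. *)
    apply: sub_sigma_algebra; exists (fun j => if j == i then B else setT).
      by move=> j; case: ifP.
    apply/seteqP; split=> [t [_ Bt] j|t Bt].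
      by case: eqP => // ->.
    by split => //; have := Bt i; rewrite eqxx.
  apply: smallest_sub; first exact: sigma_algebra_measurable.
  by move=> _ [B mB ->]; exact: measurable_box.
- move=> _ _ [B1 mB1 ->] [B2 mB2 ->].
  exists (fun i => B1 i `&` B2 i); first by move=> i; exact: measurableI.
  by apply/seteqP; split=> [t [? ?] i|t Bt] //; split=> i; have [] := Bt i.
- by move=> n; exists (fun=> `[(- n%:R)%R, n%:R%R]).
- rewrite -subTset => t _; exists (Num.bound (\sum_i `|tnth t i|)) => // i.
  rewrite /= in_itv/= -ler_norml.
  apply: le_trans (ltW (archi_boundP _)); last exact: sumr_ge0.
  by rewrite (bigD1 i)//= lerDl sumr_ge0.
- by move=> _ [B mB ->]; exact: m12.
Qed.

Lemma lebesgue_tuple_itvcc_lty (d n : nat) :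
  (lebesgue_tuple R d (box (fun=> `[(- n%:R)%R, n%:R%R])) < +oo)%E.
Proof.
rewrite (lebesgue_tuple_box (B := fun=> `[(- n%:R)%R, n%:R%R]%classic))//.
rewrite -ge0_fin_numE ?prode_ge0// prode_fin_num// => i _.
by rewrite lebesgue_measure_itv/=; case: ifP.
Qed.

(** On a box both sides are products over the coordinates, each bringing one factor [c]. Serves
    translations ([c = 1]) and the absolute value ([c = 2], [D] a half-line). *)
Lemma lebesgue_tuple_map (f : Rm -> Rm) (c : R) (D : set Rm) :
  0 <= c -> measurable_fun setT f -> measurable D ->
  (forall B : set Rm, measurable B ->
    lebesgue_measure (f @^-1` B) = (c%:E * lebesgue_measure (B `&` D))%E) ->
  forall (d : nat) (A : set (d.-tuple Rm)), measurable A ->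
  lebesgue_tuple R d [set t | A (map_tuple f t)] =
    ((c ^+ d)%:E * lebesgue_tuple R d (A `&` box (fun=> D)))%E.
Proof.
move=> c0 mf mD fB d A mA.
pose F : d.-tuple Rm -> d.-tuple Rm := fun t => map_tuple f t.
have mF : measurable_fun setT F.
  apply/measurable_fun_tnthP => i; rewrite (_ : _ \o _ = f \o (@tnth _ _ ^~ i)).
    by apply: measurableT_comp => //; exact: measurable_tnth.
  by apply/funext => t /=; rewrite tnth_map.
have mDd : measurable (box (fun=> D) : set (d.-tuple Rm)).
  by have := @measurable_box R d (fun=> D); apply.
(* The right-hand side is packaged as a measure so that uniqueness applies. *)
pose m2 := mscale (NngNum (exprn_ge0 d c0)) (mrestr (lebesgue_tuple R d) mDd).
have m12 (B : 'I_d -> set Rm) : (forall i, measurable (B i)) ->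
    pushforward (lebesgue_tuple R d) F (box B) = m2 (box B).
  move=> mB; transitivity ((c ^+ d)%:E *
    lebesgue_tuple R d (box B `&` box (fun=> D)))%E; last by [].
  rewrite /pushforward (_ : _ @^-1` _ = box (fun i => f @^-1` B i)); last first.
    by apply/seteqP; split=> t /= Bt i; have := Bt i; rewrite /F tnth_map.
  rewrite (_ : _ `&` _ = box (fun i => B i `&` D)); last first.
    apply/seteqP; split=> [t /= [Bt Dt] i //|t /= Bt].
    by split=> i; have [] := Bt i.
  rewrite (lebesgue_tuple_box (B := fun i => f @^-1` B i)); last first.
    by move=> i; rewrite -[X in measurable X]setTI; exact: mf.
  rewrite (lebesgue_tuple_box (B := fun i => B i `&` D)); last first.
    by move=> i; exact: measurableI.
  under eq_bigr do rewrite fB//.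
  rewrite big_split; congr (_ * _)%E.
  by rewrite -[in RHS](card_ord d) prodEFin prodr_const.
apply: (@box_measure_unique d (pushforward (lebesgue_tuple R d) F) m2 _ _ A) => //.
move=> n; pose Bn (i : 'I_d) : set Rm := `[(- n%:R)%R, n%:R%R]%classic.
rewrite -[X in (X < _)%E]/(pushforward (lebesgue_tuple R d) F (box Bn)).
rewrite (m12 Bn (fun=> measurable_itv _)).
rewrite lte_mul_pinfty// ?lee_fin//.
have mn : measurable (box (fun=> `[(- n%:R)%R, n%:R%R]) : set (d.-tuple Rm)).
  by have := @measurable_box R d (fun=> `[(- n%:R)%R, n%:R%R]%classic); apply.
apply: le_lt_trans (lebesgue_tuple_itvcc_lty d n).
by apply: (le_measure (lebesgue_tuple R d)); rewrite ?inE//; exact: measurableI.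
Qed.

(** A permuted box is a box with the same sides in another order, so its product of lengths is
    unchanged. *)
Lemma lebesgue_tuple_perm (d : nat) (p : {perm 'I_d}) (A : set (d.-tuple Rm)) :
  measurable A ->
  lebesgue_tuple R d [set t | A [tuple tnth t (p i) | i < d]] =
    lebesgue_tuple R d A.
Proof.
move=> mA; pose F (t : d.-tuple Rm) := [tuple tnth t (p i) | i < d].
have mF : measurable_fun setT F.
  apply/measurable_fun_tnthP => i.
  rewrite (_ : _ \o _ = (@tnth _ _ ^~ (p i))); first exact: measurable_tnth.
  by apply/funext => t /=; rewrite tnth_mktuple.
have m12 (B : 'I_d -> set Rm) : (forall i, measurable (B i)) ->
    pushforward (lebesgue_tuple R d) F (box B) = lebesgue_tuple R d (box B).
  move=> mB; rewrite /pushforward/=.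
  rewrite (_ : _ @^-1` _ = box (fun i => B (p^-1%g i))); last first.
    apply/seteqP; split=> t /= Bt i.
      by have := Bt (p^-1%g i); rewrite /F tnth_mktuple permKV.
    by have := Bt (p i); rewrite /F tnth_mktuple permK.
  rewrite (lebesgue_tuple_box (B := fun i => B (p^-1%g i)))//.
  by rewrite lebesgue_tuple_box// [RHS](reindex_inj (@perm_inj _ p^-1%g)).
apply: (@box_measure_unique d (pushforward (lebesgue_tuple R d) F)
  (lebesgue_tuple R d) _ _ A) => //.
move=> n; pose Bn (i : 'I_d) : set Rm := `[(- n%:R)%R, n%:R%R]%classic.
rewrite -[X in (X < _)%E]/(pushforward (lebesgue_tuple R d) F (box Bn)).
rewrite (m12 Bn (fun=> measurable_itv _)).
exact: lebesgue_tuple_itvcc_lty.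
Qed.

Lemma lebesgue_measure_translation (a : R) (B : set Rm) : measurable B ->
  lebesgue_measure ((fun x : R => x + a) @^-1` B) = lebesgue_measure B.
Proof.
move=> mB; have mf : measurable_fun setT (fun x : Rm => (x + a : Rm)).
  exact: measurable_funD.
rewrite -[LHS]/(pushforward lebesgue_measure (fun x : Rm => (x + a : Rm)) B).
apply/esym/lebesgue_measure_unique => //.
move=> _ [[x y]] _ <-; rewrite /= /pushforward.
rewrite (_ : _ @^-1` _ = `]x - a, y - a]%classic); last first.
  by apply/seteqP; split=> z /=; rewrite !in_itv/= ltrBlDr lerBrDr.
rewrite !lebesgue_measure_itv/= !lte_fin ltrD2r.
by case: ifP => // _; rewrite -!EFinB; congr EFin; ring.
Qed.

Lemma lebesgue_tuple_translation (a : R) (d : nat) (A : set (d.-tuple Rm)) :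
  measurable A ->
  lebesgue_tuple R d [set t | A (map_tuple (fun x => x + a) t)] =
    lebesgue_tuple R d A.
Proof.
move=> mA; rewrite (@lebesgue_tuple_map (fun x => x + a) 1 setT)//.
- rewrite expr1n mul1e; congr (lebesgue_tuple R d _).
  by apply/seteqP; split=> [t []|t].
- exact: measurable_funD.
- by move=> B mB; rewrite setIT mul1e lebesgue_measure_translation.
Qed.

(** Away from 0 the preimage is the positive part of [B] together with its mirror image; the point 0
    is null, so open and closed half-lines give the same value. *)
Lemma lebesgue_measure_norm_preimage (b : bool) (B : set Rm) : measurable B ->
  lebesgue_measure ((fun x : R => `|x|) @^-1` B) =
  (2%:E * lebesgue_measure (B `&` [set` Interval (BSide b 0%R) (BInfty R false)]))%E.
Proof.
move=> mB; pose P : set Rm := B `&` `]0, +oo[.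
have mP : measurable P by exact: measurableI.
have mN : measurable ((-%R : Rm -> Rm) @^-1` P).
  by rewrite -[X in measurable X]setTI; exact: oppr_measurable.
have m0 : lebesgue_measure (B `&` [set 0]) = 0%E.
  apply/eqP; rewrite eq_le measure_ge0 andbT -(lebesgue_measure_set1 (0 : R)).
  by rewrite le_measure ?inE//; exact: measurableI.
have m0B : measurable (B `&` [set 0]) by exact: measurableI.
have -> : lebesgue_measure (B `&` [set` Interval (BSide b 0%R) (BInfty R false)]) =
    lebesgue_measure P.
  by case: b => //; rewrite -(@setU1itv _ _ _ _ false)// setIUr setUC measureU0//.
rewrite [in LHS](_ : _ @^-1` B =
    (B `&` [set 0]) `|` (P `|` (-%R : Rm -> Rm) @^-1` P)); last first.
  apply/seteqP; split=> x; rewrite /P/= !in_itv/= !andbT.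
    case: (ltrgt0P x) => [x0|x0|->] Bx; last by left.
      by right; left.
    by right; right; rewrite oppr_gt0.
  case=> [[Bx x0]|[[Bx x0]|[Bx x0]]]; first by rewrite x0 normr0 -x0.
    by rewrite gtr0_norm.
  by rewrite ltr0_norm// -oppr_gt0.
rewrite setUC measureU0//; last exact: measurableU.
rewrite measureU//.
- by rewrite -[X in (_ + X)%E]/(pushforward _ _ P) lebesgue_measureN// mule_natl mule2n.
- apply/seteqP; split=> // x; rewrite /P/= => -[[_]]; rewrite !in_itv/= !andbT => x0 [_].
  by rewrite oppr_gt0 ltNge ltW.
Qed.

End lebesgue_tuple_theory.

(* [water_cost k x s] is k times the sup norm of x cut off at the level s plus
   the l1 norm of the excess: x is split between s *: gamma_d and a multiple
   of beta_d. *)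
Definition water_cost {R : realType} (k : R) {d : nat} (x : 'I_d -> R) (s : R) :=
  k * s + \sum_(i < d) Num.max (x i - s) 0.

(** Coordinates enter without absolute values: the set is meant to be cut by an orthant or composed
    with the absolute value. The radius [r] varies in the induction on dimension. *)
Definition gauge_ball {R : realType} (k r : R) (d : nat) :
    set (d.-tuple (measurableTypeR R)) :=
  [set t | exists2 s, 0 <= s & water_cost k (tnth t) s <= r]%classic.
Arguments gauge_ball {R} k r d.

(** * The cost as a function of the level: optimal levels, measurability, removal of the smallest
    coordinate *)

Section water_cost_theory.
Context {R : realType} (k : R).
Local Open Scope classical_set_scope.
Local Notation Rm := (measurableTypeR R).

(** Summing the coordinatewise bounds gives a cost change of at most [(c - s) * (k - n)], where [n]
    counts the coordinates above [s]; [k - n] is the right slope of the cost at [s]. *)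
Lemma water_cost_slope (d : nat) (x : 'I_d -> R) (s c : R) :
  (c - s) * (k - #|[pred i | s < x i]|%:R) <= 0 ->
  (forall i, Num.max (x i - c) 0 <=
    Num.max (x i - s) 0 + (if s < x i then s - c else 0)) ->
  water_cost k x c <= water_cost k x s.
Proof.
move=> slope xc; have := ler_sum (index_enum 'I_d) (fun i (_ : true) => xc i).
rewrite big_split/= -big_mkcond/= sumr_const -mulr_natr /water_cost.
by move: slope; set n := #|_|%:R; nra.
Qed.

(* [water_cost k x] is piecewise affine; replacing the uncountable union over
   levels by this finite one is what makes [gauge_ball] measurable. *)
Lemma water_cost_breakpoint (d : nat) (x : 'I_d -> R) (s : R) : 0 <= k -> 0 <= s ->
  exists2 c, (c = 0 \/ exists2 j, 0 <= x j & c = x j) &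
    water_cost k x c <= water_cost k x s.
Proof.
(* If the slope is nonnegative, lower the level to the largest coordinate in [[0, s]], or to 0 if
   there is none. *)
move=> k0 s0; have [kn|kn] := leP #|[pred i | s < x i]|%:R k.
  have [[i0 /andP[xi0 xis]]|noi] := pselect (exists i, 0 <= x i <= s).
    have i0P : [pred i | 0 <= x i <= s] i0 by apply/andP.
    have [j /andP[xj0 xjs] xj] := arg_maxP x i0P.
    exists (x j); first by right; exists j.
    apply: water_cost_slope; first by nra.
    move=> i; case: ltP => xis'; first by rewrite !max_l; lra.
    rewrite [leLHS]max_r ?[X in _ <= X + _]max_r; try lra.
    have [xi_ge0|xi_lt0] := leP 0 (x i); last lra.
    by have := xj i; rewrite /= xi_ge0 xis' => /(_ isT); lra.
  exists 0; first by left.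
  apply: water_cost_slope; first by nra.
  move=> i; case: ltP => xis'; first by rewrite !max_l; lra.
  rewrite [leLHS]max_r ?[X in _ <= X + _]max_r; try lra.
  have [xi_ge0|xi_lt0] := leP 0 (x i); last lra.
  by exfalso; apply: noi; exists i; rewrite xi_ge0.
(* The slope is negative: raise the level to the smallest coordinate above [s]. *)
have [i0 si0] : exists i, s < x i.
  apply/not_existsP => nos; move: kn; rewrite eq_card0 ?ltNge ?k0// => i.
  by apply/negP => ?; apply: (nos i).
have [j xsj xj] := @arg_minP _ _ _ i0 [pred i | s < x i] x si0.
exists (x j); first by right; exists j => //; rewrite /= in xsj; lra.
rewrite /= in xsj.
apply: water_cost_slope; first by nra.
move=> i; case: ltP => xis.
  by have := xj i xis => xji; rewrite !max_l; lra.
by rewrite !max_r; lra.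
Qed.

Lemma measurable_gauge_ball (r : R) (d : nat) : 0 <= k ->
  measurable (gauge_ball k r d).
Proof.
move=> k0.
rewrite (_ : gauge_ball k r d =
    [set t | water_cost k (tnth t) 0 <= r] `|`
    \bigcup_(j in [set: 'I_d])
      ([set t | 0 <= tnth t j] `&`
       [set t | water_cost k (tnth t) (tnth t j) <= r])); last first.
  apply/seteqP; split=> [t [s s0 sr]|t [t0|[j _ [tj0 tj]]]].
  - have [c [->|[j xj0 ->]] cs] := water_cost_breakpoint _ (tnth t) _ k0 s0.
      by left; apply: le_trans cs sr.
    by right; exists j => //; split => //; apply: le_trans cs sr.
  - by exists 0.
  - by exists (tnth t j).
have mle (f g : d.-tuple Rm -> Rm) : measurable_fun setT f ->
    measurable_fun setT g -> measurable [set t | f t <= g t].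
  move=> mf mg; rewrite -[X in measurable X]setTI.
  have /(_ measurableT [set true]) := measurable_fun_ler mf mg.
  by apply.
have mc (f : d.-tuple Rm -> Rm) : measurable_fun setT f ->
    measurable [set t | water_cost k (tnth t) (f t) <= r].
  move=> mf; apply: mle; last exact: measurable_cst.
  apply: measurable_funD; first exact: measurable_funM.
  apply: measurable_sum => i; apply: measurable_maxr => //.
  by apply: measurable_funB => //; exact: measurable_tnth.
apply: measurableU; first exact: (mc (fun=> 0)).
apply: fin_bigcup_measurable => // j _; apply: measurableI.
  by apply: mle => //; exact: measurable_tnth.
by apply: mc; exact: measurable_tnth.
Qed.

(** Levels above [a] correspond to levels for [t] by a shift of [a], which costs [k * a]. Below [a]
    every coordinate exceeds the level, so the cost is affine in the level with slope [k - d.+1]. *)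
Lemma gauge_ball_cons (d : nat) (r a : R) (t : d.-tuple Rm) :
  0 < k -> 0 <= a -> (forall i, 0 <= tnth t i) ->
  gauge_ball k r d.+1 (tcons (a, map_tuple (fun x => x + a) t)) <->
  gauge_ball k (r - Num.min k d.+1%:R * a) d t.
Proof.
move=> k0 a0 t0.
have costE s : water_cost k (tnth (tcons (a, map_tuple (fun x => x + a) t))) s =
    k * s + (Num.max (a - s) 0 + \sum_(i < d) Num.max (tnth t i + a - s) 0).
  rewrite /water_cost big_ord_recl/= tnth0; congr (_ + (_ + _)).
  by apply: eq_bigr => i _; rewrite tnthS tnth_map.
split=> -[s s0]; rewrite ?costE.
  have [as_|sa] := leP a s => sr.
    exists (s - a); first lra.
    apply: le_trans (_ : k * (s - a) + \sum_i Num.max (tnth t i + a - s) 0 <= _).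
      rewrite lerD2l ler_sum// => i _; rewrite (_ : _ - (s - a) = tnth t i + a - s)//.
      by ring.
    rewrite max_r ?add0r in sr; last lra.
    have : Num.min k d.+1%:R * a <= k * a by rewrite ler_wpM2r// ge_min lexx.
    by lra.
  exists 0 => //; rewrite /water_cost mulr0 add0r.
  have -> : \sum_i Num.max (tnth t i - 0) 0 = \sum_i tnth t i.
    by apply: eq_bigr => i _; rewrite subr0 max_l.
  rewrite max_l in sr; last lra.
  have e : \sum_i Num.max (tnth t i + a - s) 0 = \sum_i tnth t i + d%:R * (a - s).
    rewrite (_ : d%:R * _ = \sum_(i < d) (a - s)); last first.
      by rewrite sumr_const card_ord mulr_natl.
    rewrite -big_split/=.
    by apply: eq_bigr => i _; have := t0 i => ti; rewrite max_l; lra.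
  rewrite e in sr.
  (* The weights [s] and [a - s] are nonnegative with sum [a]. *)
  have : Num.min k d.+1%:R * a <= k * s + d.+1%:R * (a - s).
    have [kd|kd] := leP k d.+1%:R.
      have : 0 <= (a - s) * (d.+1%:R - k) by rewrite mulr_ge0// subr_ge0// ltW.
      lra.
    have : 0 <= s * (k - d.+1%:R) by rewrite mulr_ge0// subr_ge0// ltW.
    lra.
  by rewrite -natr1; lra.
rewrite /water_cost => sr.
have [kd|kd] := leP k d.+1%:R; rewrite -natr1 in kd sr *.
  rewrite min_l// in sr.
  exists (s + a); first lra.
  rewrite costE max_r ?add0r; last lra.
  have -> : \sum_i Num.max (tnth t i + a - (s + a)) 0 = \sum_i Num.max (tnth t i - s) 0.
    by apply: eq_bigr => i _; congr Num.max; ring.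
  by lra.
rewrite min_r in sr; last exact: ltW.
(* For [k > d.+1] level 0 is optimal: undoing the level [s] saves [k * s] and adds at most
   [d%:R * s]. *)
exists 0 => //; rewrite costE mulr0 add0r subr0 max_l//.
have e : \sum_i Num.max (tnth t i + a - 0) 0 <=
    \sum_i Num.max (tnth t i - s) 0 + d%:R * (s + a).
  rewrite (_ : d%:R * _ = \sum_(i < d) (s + a)); last first.
    by rewrite sumr_const card_ord mulr_natl.
  rewrite -big_split/=.
  apply: ler_sum => i _; have := t0 i => ti.
  have : tnth t i - s <= Num.max (tnth t i - s) 0 by rewrite le_max lexx.
  by move=> tis; rewrite [leLHS]max_l; lra.
by nra.
Qed.

End water_cost_theory.

(** * Description of [rho] by the cost of a level *)

Section convex_hull_theory.
Context {R : realType}.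
Local Open Scope classical_set_scope.

Lemma convex_setP (V : lmodType R) (A : set V) :
  convex_set (A : set (convex_lmodType V)) <->
  forall (x y : V) (l : R), 0 <= l <= 1 -> A x -> A y ->
    A (l *: x + (1 - l) *: y).
Proof.
split=> [cA x y l /andP[l0 l1] Ax Ay|cA x y l].
  by have := cA x y (Itv01 l0 l1); rewrite !inE; apply.
rewrite !inE => Ax Ay; apply: cA => //.
by rewrite ge0 le1.
Qed.

(** Split off the first vector and renormalize the remaining weights by [1 - w ord0]; any missing
    weight falls on the point 0. *)
Lemma convex_set_sum (V : lmodType R) (A : set V) :
  convex_set (A : set (convex_lmodType V)) -> A 0 ->
  forall (n : nat) (v : 'I_n -> V) (w : 'I_n -> R),
  (forall i, A (v i)) -> (forall i, 0 <= w i) -> \sum_i w i <= 1 ->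
  A (\sum_i w i *: v i).
Proof.
move=> /convex_setP cA A0; elim=> [|n IH] v w Av w0 w1; first by rewrite big_ord0.
have wl0 : 0 <= \sum_(i < n) w (lift ord0 i) by exact: sumr_ge0.
rewrite big_ord_recl in w1; rewrite big_ord_recl.
rewrite [X in A (_ + X)](_ : _ =
    (1 - w ord0) *: \sum_(i < n) (w (lift ord0 i) / (1 - w ord0)) *:
      v (lift ord0 i)); last first.
  rewrite scaler_sumr; apply: eq_bigr => i _; rewrite scalerA.
  (* When the first weight is 1, all the others vanish, in agreement with division by 0 giving 0. *)
  have [w01|w01] := eqVneq (1 - w ord0) 0; last by rewrite mulrC divfK.
  rewrite w01 mul0r.
  have e : \sum_(j < n) w (lift ord0 j) =
      w (lift ord0 i) + \sum_(j < n | j != i) w (lift ord0 j) by rewrite (bigD1 i).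
  have : 0 <= \sum_(j < n | j != i) w (lift ord0 j) by exact: sumr_ge0.
  have := w0 (lift ord0 i) => wi; move=> ?; rewrite (_ : w (lift ord0 i) = 0) //.
  by rewrite e in w1; lra.
apply: cA => //.
  by have := w0 ord0; lra.
apply: IH => //.
  by move=> i; rewrite divr_ge0//; lra.
rewrite -mulr_suml; have [w01|w01] := eqVneq (1 - w ord0) 0.
  by rewrite w01 invr0 mulr0.
by rewrite ler_pdivrMr ?mul1r; have := w0 ord0; rewrite ?lt_def ?w01; lra.
Qed.

(** The point 0 is the midpoint of two opposite vertices, and [x] combines signed unit vectors with
    weights [|x_i|] of sum at most 1. *)
Lemma cross_polytope_mem (d : nat) (x : 'rV[R]_d) : (1 <= d)%N ->
  \sum_i `|x 0 i| <= 1 -> cross_polytope R d x.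
Proof.
move=> d0 x1 C [cC Cv].
have C0 : C 0.
  have := (convex_setP _ _).1 cC (delta_mx 0 (Ordinal d0)) (- delta_mx 0 (Ordinal d0)) 2^-1.
  rewrite scalerN -scalerBl (_ : 2^-1 - (1 - 2^-1) = 0 :> R) ?scale0r; last lra.
  by apply; [lra|apply: Cv; exists (Ordinal d0); left|
    apply: Cv; exists (Ordinal d0); right].
pose v i : 'rV[R]_d := Num.sg (x 0 i) *: delta_mx 0 i.
have -> : x = \sum_i `|x 0 i| *: v i.
  rewrite [LHS]row_sum_delta; apply: eq_bigr => i _.
  by rewrite scalerA mulrC -numEsg.
apply: convex_set_sum => // i; rewrite /v; case: sgrP => _.
- by rewrite scale0r.
- by rewrite scale1r; apply: Cv; exists i; left.
- by rewrite scaleN1r; apply: Cv; exists i; right.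
Qed.

(** The cost is jointly convex in point and level, so the right-hand side is convex; vertices of the
    cross-polytope enter at level 0, the scaled cube at level [k^-1]. The converse clips [x] at
    level [s]. *)
Lemma rho_water_cost (d : nat) (k : R) : (1 <= d)%N -> 0 < k ->
  rho R d k =
  [set x | exists2 s, 0 <= s & water_cost k (fun i => `|x 0 i|) s <= 1].
Proof.
move=> d1 k0; set S := [set x | _].
have cS : convex_set (S : set (convex_lmodType 'rV[R]_d)).
  apply/convex_setP => x y l /andP[l0 l1] [s s0 sx] [t t0 ty].
  exists (l * s + (1 - l) * t); first by rewrite addr_ge0// mulr_ge0// subr_ge0.
  apply: (@le_trans _ _ (l * water_cost k (fun i => `|x 0 i|) s +
      (1 - l) * water_cost k (fun i => `|y 0 i|) t)); last by nra.
  rewrite /water_cost !mulrDr !mulr_sumr addrACA -big_split/=.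
  rewrite lerD//; first by rewrite le_eqVlt; apply/orP; left; apply/eqP; ring.
  apply: ler_sum => i _; rewrite !mxE ge_max; apply/andP; split; last first.
    by rewrite addr_ge0// mulr_ge0 ?subr_ge0// le_max lexx orbT.
  have := ler_normD (l * x 0 i) ((1 - l) * y 0 i).
  rewrite !normrM (ger0_norm l0) (@ger0_norm _ (1 - l)) ?subr_ge0// => n.
  have mx : `|x 0 i| - s <= Num.max (`|x 0 i| - s) 0 by rewrite le_max lexx.
  have my : `|y 0 i| - t <= Num.max (`|y 0 i| - t) 0 by rewrite le_max lexx.
  have := ler_wpM2l l0 mx; have := @ler_wpM2l _ (1 - l) _ _ _ my.
  by rewrite subr_ge0 => /(_ l1); lra.
apply/seteqP; split.
  apply: smallest_sub => // x [|[y y1 <-{x}]].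
    move: x; apply: smallest_sub => // x [i xi]; exists 0 => //.
    rewrite /water_cost mulr0 add0r (bigD1 i)//= big1 ?addr0 => [|j ji].
      by case: xi => ->; rewrite !mxE !eqxx ?normrN normr1 subr0 max_l.
    by case: xi => ->; rewrite !mxE (negbTE ji) andbF ?normrN normr0 subr0 max_l.
  exists k^-1; first by rewrite invr_ge0 ltW.
  rewrite /water_cost mulfV ?gt_eqF// big1 ?addr0// => i _.
  rewrite max_r// mxE normrM subr_le0 gtr0_norm ?invr_gt0//.
  by rewrite -[leRHS]mulr1 ler_pM2l ?invr_gt0// ler_norml.
move=> x [s s0 sx] C [/convex_setP cC sC].
(* [b] is [x] clipped to the cube of half-side [s]; it will receive weight [k * s], and the excess
   [x - b] the rest. *)
pose b : 'rV[R]_d := \row_i Num.max (- s) (Num.min s (x 0 i)).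
have bs i : `|b 0 i| <= s.
  by rewrite mxE ler_norml le_max lexx/= ge_max ge_min lexx andbT; lra.
have xb i : `|x 0 i - b 0 i| = Num.max (`|x 0 i| - s) 0.
  rewrite mxE; case: (leP s (x 0 i)) => sx1.
    rewrite max_r; last lra.
    rewrite [RHS]max_l; rewrite !ger0_norm; lra.
  case: (leP (- s) (x 0 i)) => sx2.
    rewrite subrr normr0 max_r// subr_le0 ler_norml; lra.
  rewrite max_l; rewrite !ler0_norm; lra.
pose l := k * s.
have l0 : 0 <= l by rewrite mulr_ge0// ltW.
have xbl : \sum_i `|(x - b) 0 i| <= 1 - l.
  rewrite -(@lerD2l _ l); apply: le_trans (_ : water_cost k (fun i => `|x 0 i|) s <= _).
    by rewrite lerD2l ler_sum// => i _; rewrite -xb !mxE.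
  lra.
have xbl0 : 0 <= \sum_i `|(x - b) 0 i| by exact: sumr_ge0.
(* Covers the degenerate weights 0 and 1, where one of the two components is zero. *)
have cancel_scale (c : R) (y : 'rV[R]_d) : (c = 0 -> y = 0) ->
    c *: (c^-1 *: y) = y.
  have [->|c0] := eqVneq c 0; first by move=> ->//; rewrite !scaler0.
  by rewrite scalerA mulfV// scale1r.
have b0 : s = 0 -> b = 0.
  move=> s00; apply/rowP => i; rewrite [RHS]mxE; apply: normr0_eq0.
  by have := bs i; have := normr_ge0 (b 0 i); lra.
have lE : l^-1 *: b = k^-1 *: (s^-1 *: b) by rewrite scalerA -invfM.
have -> : x = (1 - l) *: ((1 - l)^-1 *: (x - b)) + (1 - (1 - l)) *: (l^-1 *: b).
  rewrite !subKr !cancel_scale ?subrK//.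
    by move/eqP; rewrite mulf_eq0 gt_eqF//= => /eqP.
  move=> l1; apply/rowP => i; rewrite [RHS]mxE; apply: normr0_eq0.
  move: xbl xbl0; rewrite (bigD1 i)//=.
  have := normr_ge0 ((x - b) 0 i); rewrite l1 => ? ? ?.
  have : 0 <= \sum_(j | j != i) `|(x - b) 0 j| by exact: sumr_ge0.
  lra.
apply: cC; first lra.
  apply: sC; left; apply: cross_polytope_mem => //.
  under eq_bigr do rewrite mxE normrM.
  rewrite -mulr_sumr ger0_norm ?invr_ge0; last lra.
  have [l1|l1] := eqVneq (1 - l) 0; first by rewrite l1 invr0 mul0r.
  by rewrite mulrC ler_pdivrMr ?mul1r// lt_def l1; lra.
apply: sC; right; exists (s^-1 *: b) => // i.
rewrite mxE -ler_norml normrM ger0_norm ?invr_ge0//.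
have [->|s1] := eqVneq s 0; first by rewrite invr0 mul0r.
by rewrite mulrC ler_pdivrMr ?mul1r// lt_def s1.
Qed.

End convex_hull_theory.

(** * Slicing the body along its smallest coordinate *)

Section orthant_volume.
Context {R : realType}.
Local Open Scope classical_set_scope.
Local Notation Rm := (measurableTypeR R).
Local Notation mu := (@lebesgue_measure R).

Lemma integral_affine_expr (b : bool) (C r c : R) (n : nat) : 0 <= r -> 0 < c ->
  (\int[mu]_(x in [set` Interval (BSide b 0%R) (BRight (r / c)%R)])
    (C * (r - c * x) ^+ n)%:E)%E =
  (C * (r ^+ n.+1 / (c * n.+1%:R)))%:E.
Proof.
move=> r0 c0.
pose P : {poly R} := (- C / (c * n.+1%:R))%:P * (r%:P - c%:P * 'X) ^+ n.+1.
have dP x : P^`().[x] = C * (r - c * x) ^+ n.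
  rewrite /P mul_polyC derivZ deriv_exp derivB derivC mul_polyC derivZ derivX sub0r.
  rewrite -[_ *+ n.+1]mulr_natr !hornerE/= ?hornerMn ?hornerE/=.
  have n0 : 1 + n%:R != 0 :> R by rewrite nat1r pnatr_eq0.
  have c1 : c != 0 by rewrite gt_eqF.
  by field; rewrite n0.
have mP : measurable_fun `]0%R, r / c[%classic (fun x => (C * (r - c * x) ^+ n)%:E).
  rewrite [X in measurable_fun _ X](_ : _ = EFin \o horner P^`()).
    apply/measurable_EFinP/measurable_funTS.
    by apply: continuous_measurable_fun; exact: continuous_horner.
  by apply/funext => x /=; rewrite dP.
rewrite integral_itv_bndoo//.
(* The fundamental theorem is applied on a nondegenerate interval; here [r = 0] and both sides
   vanish. *)
have [rc0|rc0] := eqVneq (r / c) 0.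
  rewrite rc0 set_itvoo0 integral_set0 (_ : r = 0) ?expr0n ?mul0r ?mulr0//.
  by move: rc0; move/eqP; rewrite mulf_eq0 invr_eq0 (gt_eqF c0) orbF => /eqP.
have rc1 : 0 < r / c by rewrite lt_def rc0 divr_ge0// ltW.
rewrite -(@integral_itv_bndoo _ _ _ _ true false)//.
under eq_integral do rewrite -dP.
rewrite (@continuous_FTC2 _ _ (horner P))//.
- rewrite -EFinB; congr EFin. rewrite /P !hornerE/= subr0.
  have -> : r - c * r / c = 0 by rewrite mulrAC mulfV ?gt_eqF// mul1r subrr.
  by rewrite expr0n/= mulr0 sub0r; ring.
- by apply: continuous_subspaceT; exact: continuous_horner.
- split=> [x _||]; first exact: derivable_horner.
    by apply: cvg_at_right_filter; exact: continuous_horner.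
  by apply: cvg_at_left_filter; exact: continuous_horner.
- by move=> x _; rewrite derivE.
Qed.

Lemma lebesgue_tupleS (d : nat) (A : set (d.+1.-tuple Rm)) :
  lebesgue_tuple R d.+1 A =
  (\int[mu]_x lebesgue_tuple R d [set t | A (tcons (x, t))])%E.
Proof.
apply: eq_integral => x _ /=; congr (lebesgue_tuple R d _).
by apply/seteqP; split=> t; rewrite /xsection/= inE.
Qed.

(** Closed for [true], open for [false]: subtracting a weak or strict minimum from the other
    coordinates leaves one or the other. *)
Definition orthant (b : bool) (d : nat) : set (d.-tuple Rm) :=
  [set t | forall i, tnth t i \in Interval (BSide b 0) (BInfty R false)].

(* The flag selects weak (true) or strict (false) minima. *)
Definition min_at (c : bool) (d : nat) (j : 'I_d) : set (d.-tuple Rm) :=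
  [set t | forall i, i != j -> tnth t j < tnth t i ?<= if c].

Lemma measurable_orthant b d : measurable (orthant b d).
Proof.
exact: (measurable_box (B := fun=> [set` Interval (BSide b 0) (BInfty R false)])).
Qed.

Lemma measurable_min_at c d j : measurable (min_at c d j).
Proof.
rewrite (_ : min_at c d j = \bigcap_(i in [set: 'I_d])
    [set t | (i == j) || (tnth t j < tnth t i ?<= if c)]).
  apply: fin_bigcap_measurable => // i _.
  have [_|_] := eqVneq i j.
    by rewrite (_ : mkset _ = setT)//; apply/seteqP; split.
  rewrite -[X in measurable X]setTI.
  have mt (l : 'I_d) := @measurable_tnth _ Rm d l.
  have /(_ measurableT [set true]) := measurable_fun_ler (mt j) (mt i).
  have /(_ measurableT [set true]) := measurable_fun_ltr (mt j) (mt i).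
  by case: c; rewrite /= => ml mle; [apply: mle|apply: ml].
apply/seteqP; split=> t /= tj i; first by move=> _; have := tj i; case: eqP => // _; apply.
by move=> ij; have := tj i Logic.I; rewrite (negbTE ij).
Qed.

(** Translating the other coordinates by [x] turns minimality of [x] into the orthant condition with
    flag [c], and [gauge_ball_cons] lowers the radius. *)
Lemma gauge_min_slice (k r x : R) (b c : bool) (d : nat) : 0 < k ->
  x \in Interval (BSide b 0) (BInfty R false) ->
  lebesgue_tuple R d [set t | (gauge_ball k r d.+1 `&` orthant b d.+1 `&`
    min_at c d.+1 ord0) (tcons (x, t))] =
  lebesgue_tuple R d (gauge_ball k (r - Num.min k d.+1%:R * x) d `&` orthant c d).
Proof.
move=> k0 x0; set A := (X in lebesgue_tuple R d X = _).
have mA : measurable A.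
  rewrite -[A]setTI.
  have : measurable_fun setT (fun t : d.-tuple Rm => tcons ((x : Rm), t)).
    apply: (measurableT_comp (@measurable_tcons _ Rm d)).
    exact: measurable_fun_pair.
  apply => //; apply: measurableI; last exact: measurable_min_at.
  by apply: measurableI; [apply: measurable_gauge_ball; exact: ltW|exact: measurable_orthant].
have xge0 : 0 <= x by move: x0; rewrite in_itv/= andbT => /lteifW.
rewrite -(lebesgue_tuple_translation x)//.
congr (lebesgue_tuple R d _); apply/seteqP; split=> t.
  move=> [[gt _] mt].
  have t0 : orthant c d t.
    move=> i; have := mt (lift ord0 i) isT.
    by rewrite tnth0 tnthS tnth_map in_itv/= andbT -lteifBlDr subrr.
  split => //; apply/gauge_ball_cons => // i.
  by have := t0 i; rewrite in_itv/= andbT => /lteifW.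
move=> [gt t0]; have tp i : 0 < tnth t i ?<= if c.
  by have := t0 i; rewrite in_itv/= andbT.
have min_x i : x < tnth t i + x ?<= if c by rewrite -lteifBlDr subrr.
split.
  split; first by apply/gauge_ball_cons => // i; exact: lteifW (tp i).
  move=> i; rewrite in_itv/= andbT; case: (unliftP ord0 i) => [j ->|->].
    rewrite tnthS tnth_map.
    rewrite in_itv/= andbT in x0; have := lteif_trans x0 (min_x j).
    by apply: lteif_imply; case: (b) (c) => -[].
  by rewrite tnth0; move: x0; rewrite in_itv/= andbT.
move=> i; case: (unliftP ord0 i) => [j -> _|->]; last by rewrite eqxx.
by rewrite tnth0 tnthS tnth_map.
Qed.

End orthant_volume.

(** * Induction on the dimension for the orthant volume *)

Section orthant_volume_induction.
Context {R : realType} (k : R).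
Hypothesis k_gt0 : 0 < k.
Local Open Scope classical_set_scope.
Local Notation Rm := (measurableTypeR R).
Local Notation body r b d := (gauge_ball k r d `&` orthant b d).

Lemma measurable_body r b d : measurable (body r b d).
Proof.
apply: measurableI; last exact: measurable_orthant.
by apply: measurable_gauge_ball; exact: ltW.
Qed.

Lemma gauge_ball_lt0 r d : r < 0 -> gauge_ball k r d = set0.
Proof.
move=> r0; rewrite -subset0 => t [s s0]; rewrite leNgt => /negP; apply.
apply: lt_le_trans r0 _; rewrite addr_ge0 ?mulr_ge0 ?(ltW k_gt0)//.
by apply: sumr_ge0 => i _; rewrite le_max lexx orbT.
Qed.

(** The transposition of [ord0] and [j] preserves volume and the body, and exchanges the two
    pieces. *)
Lemma body_min_swap r b c d (j : 'I_d.+1) :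
  lebesgue_tuple R d.+1 (body r b d.+1 `&` min_at c d.+1 j) =
  lebesgue_tuple R d.+1 (body r b d.+1 `&` min_at c d.+1 ord0).
Proof.
rewrite -[RHS](lebesgue_tuple_perm _ (tperm ord0 j)); last first.
  by apply: measurableI; [exact: measurable_body|exact: measurable_min_at].
congr (lebesgue_tuple R d.+1 _); apply/seteqP.
have costE (t : d.+1.-tuple Rm) s :
    water_cost k (tnth [tuple tnth t (tperm ord0 j i) | i < d.+1]) s =
    water_cost k (tnth t) s.
  rewrite /water_cost [in RHS](reindex_inj (@perm_inj _ (tperm ord0 j))).
  by congr (_ + _); apply: eq_bigr => i _; rewrite tnth_mktuple.
split=> t [[[s s0 ts] ot] mt].
  split; first split.
  - by exists s => //; rewrite costE.
  - by move=> i; rewrite tnth_mktuple; exact: ot.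
  - move=> i i0; rewrite !tnth_mktuple tpermL; apply: mt.
    by rewrite -(inj_eq (@perm_inj _ (tperm ord0 j))) tpermK tpermR.
split; first split.
- by exists s => //; rewrite -costE.
- by move=> i; have := ot (tperm ord0 j i); rewrite tnth_mktuple tpermK.
- move=> i ij; have := mt (tperm ord0 j i); rewrite !tnth_mktuple tpermL tpermK.
  by apply; rewrite -(inj_eq (@perm_inj _ (tperm ord0 j))) tpermK tpermL.
Qed.

Lemma body_min_volume r b c d C : 0 <= r ->
  (forall r', 0 <= r' -> lebesgue_tuple R d (body r' c d) = (r' ^+ d * C)%:E) ->
  lebesgue_tuple R d.+1 (body r b d.+1 `&` min_at c d.+1 ord0) =
  (r ^+ d.+1 * (C / (Num.min k d.+1%:R * d.+1%:R)))%:E.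
Proof.
move=> r0 IH; set c0 := Num.min k d.+1%:R.
have c0_gt0 : 0 < c0 by rewrite lt_min k_gt0 ltr0n.
transitivity (C * (r ^+ d.+1 / (c0 * d.+1%:R)))%:E; last by congr EFin; ring.
rewrite -(integral_affine_expr b)// lebesgue_tupleS [RHS]integral_mkcond.
apply: eq_integral => x _; rewrite patchE.
(* Outside this interval the slice is empty: either [x] violates the orthant condition or the
   lowered radius is negative. *)
have itvE : (x \in [set` Interval (BSide b 0%R) (BRight (r / c0))]) =
    (x \in Interval (BSide b 0) (BInfty R false)) && (c0 * x <= r).
  rewrite mem_setE !in_itv/= andbT ler_pdivlMr// mulrC.
  by [].
rewrite itvE; have [x0|x0] := boolP (x \in _) => /=; last first.
  rewrite [X in lebesgue_tuple R d X](_ : _ = set0) ?measure0//.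
  rewrite -subset0 => t [[_ ot] _]; move/negP: x0; apply.
  by have := ot ord0; rewrite tnth0.
rewrite gauge_min_slice//; have [xr|xr] := leP (c0 * x) r.
  by rewrite IH ?subr_ge0// mulrC.
by rewrite gauge_ball_lt0 ?set0I ?measure0// subr_lt0.
Qed.

(** The induction keeps [b] general, since weak pieces call on the closed orthant and strict pieces
    on the open one. *)
Lemma orthant_volume r b d : 0 <= r ->
  lebesgue_tuple R d (body r b d) =
  (r ^+ d * \prod_(i < d) (Num.min k i.+1%:R)^-1)%:E.
Proof.
elim: d b r => [|d IH] b r r0.
  rewrite big_ord0 expr0 mulr1 /= diracE mem_set//; split; last by case.
  by exists 0 => //; rewrite /water_cost big_ord0 mulr0 addr0.
set v := (X in _ = X).
(* The sets [min_at true] cover the space and the sets [min_at false] are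
   disjoint, so equal volumes of the pieces make both bounds on the left-hand
   side coincide with v. *)
have mA c j : measurable (body r b d.+1 `&` min_at c d.+1 j).
  by apply: measurableI; [exact: measurable_body|exact: measurable_min_at].
have wE c : (\sum_(j \in [set: 'I_d.+1])
    lebesgue_tuple R d.+1 (body r b d.+1 `&` min_at c d.+1 j))%E = v.
  rewrite (_ : [set: 'I_d.+1] = [set` enum 'I_d.+1]); last first.
    by apply/seteqP; split=> j //= _; rewrite mem_enum.
  rewrite -fsbig_seq ?enum_uniq//.
  under eq_bigr => j _ do rewrite body_min_swap (body_min_volume _ _ _ _ _ r0 (IH c)).
  rewrite big_enum/= sumEFin sumr_const card_ord /v big_ord_recr/=.
  congr EFin; have d0 : d.+1%:R != 0 :> R by rewrite pnatr_eq0.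
  by rewrite -[LHS]mulr_natr -mulrA; congr (_ * _); rewrite -mulrA invfM divfK.
apply/eqP; rewrite eq_le; apply/andP; split.
  rewrite -(wE true); apply: content_sub_fsum => //.
  - exact: finite_finset.
  - exact: measurable_body.
  - move=> t bt; have [j _ jmin] := @arg_minP _ _ _ (ord0 : 'I_d.+1) xpredT (tnth t) isT.
    by exists j => //; split=> // i _; exact: jmin.
have tI : trivIset setT (fun j => body r b d.+1 `&` min_at false d.+1 j).
  apply/trivIsetP => i j _ _ ij; rewrite -subset0 => t [[_ ti] [_ tj]].
  have := ti j; have := tj i; rewrite ij eq_sym ij => /(_ isT) a /(_ isT) b'.
  by have := lt_trans a b'; rewrite ltxx.
have bm : measurable (\bigcup_j (body r b d.+1 `&` min_at false d.+1 j)).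
  by apply: fin_bigcup_measurable => //; exact: finite_finset.
rewrite -(wE false) -measure_fin_bigcup//; last exact: finite_finset.
apply: le_measure; rewrite ?inE//; first exact: measurable_body.
by move=> t [j _ []].
Qed.

End orthant_volume_induction.

(** Here [m] is the floor of [k]: the factors with [i < m] have minimum [i.+1] and give the
    factorial, the other [d - m] have minimum [k]. *)
Lemma prod_min_inv {R : realFieldType} (k : R) (m d : nat) :
  (m <= d)%N -> m%:R <= k < m.+1%:R ->
  \prod_(i < d) (Num.min k i.+1%:R)^-1 = k ^- (d - m) / (m`!)%:R.
Proof.
move=> md /andP[mk km].
rewrite -(big_mkord xpredT (fun i => (Num.min k i.+1%:R)^-1)).
rewrite (big_cat_nat (leq0n m) md)/= mulrC; congr (_ * _).
  rewrite (eq_big_nat _ _ (F2 := fun=> k^-1)); last first.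
    move=> i /andP[mi _]; rewrite min_l//.
    by apply: le_trans (ltW km) _; rewrite ler_nat.
  by rewrite prodr_const_nat exprVn.
rewrite fact_prod natr_prod -prodfV big_add1/=.
apply: eq_big_nat => i /andP[_ im]; rewrite min_r//.
by apply: le_trans mk; rewrite ler_nat.
Qed.

Theorem theorem3p4 (R : realType) (d : nat) (k : R)
    (hd : (1 <= d)%N) (hk : 1 <= k <= d%:R) :
  volume (rho R d k) =
    (2 ^+ d * k ^ (Num.floor k - d%:Z) / (`|Num.floor k|%N`!)%:R)%:E.
Proof.
have /andP[k1 kd] := hk; have k0 : 0 < k by lra.
rewrite /volume rho_water_cost//.
pose Rm := measurableTypeR R.
transitivity (lebesgue_tuple R d [set t : d.-tuple Rm |
    gauge_ball k 1 d (map_tuple (fun x => `|x|) t)]%classic).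
  congr (lebesgue_tuple R d _); apply/seteqP.
  have costE (t : d.-tuple Rm) s :
      water_cost k (fun i => `|(\row_j tnth t j : 'rV[R]_d) 0 i|) s =
      water_cost k (tnth (map_tuple (fun x : Rm => `|x| : Rm) t)) s.
    by congr (_ + _); apply: eq_bigr => i _; rewrite mxE tnth_map.
  by split=> t /= [s s0 ts]; exists s => //; [rewrite -costE|rewrite costE].
(* Folding by the absolute value doubles length in each coordinate, whence [2 ^+ d] times the closed
   orthant part. *)
rewrite (lebesgue_tuple_map _ 2 [set` Interval (BSide true (0 : R)) (BInfty R false)]%classic)//.
- rewrite -/(orthant true d) orthant_volume// expr1n mul1r -EFinM; congr EFin.
  have [m mE] : exists m : nat, Num.floor k = m%:Z.
    exists `|Num.floor k|%N; rewrite gez0_abs// floor_ge0; lra.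
  have := floor_itv k; rewrite mE => /andP[mk km].
  have md : (m <= d)%N by rewrite -(ler_nat R); exact: le_trans kd.
  rewrite (prod_min_inv _ m)//; last first.
    by rewrite mk -natr1; move: km; rewrite intrD.
  rewrite mulrA absz_nat; congr (_ * _ / _).
  (* Since [m <= d], the integer exponent is the opposite of the natural number [d - m]. *)
  by rewrite -opprB subzn// -exprnN.
- exact: normr_measurable.
- move=> B mB; exact: lebesgue_measure_norm_preimage.
- exact: measurable_gauge_ball (ltW k0).
Qed.
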